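(* Let $A\in\mathbb{R}^{n\times n}$, $B\in\mathbb{R}^{n\times p}$, $C\in\mathbb{R}^{q\times n}$ be given such that there exists a matrix $\tilde{A}\in\mathbb{R}^{q\times q}$ with $CA=\tilde{A}C$ and $(\tilde{A},CB)$ controllable. Let $Q\in\mathbb{R}^{q\times q}$ and $R\in\mathbb{R}^{p\times p}$ with $Q>0$, $R>0$. Then the solution to the linear quadratic regulator problem $$\underset{u(\cdot)}{\text{minimize}}\ \int_0^\infty\left(y^\top Qy+u^\top Ru\right)dt\quad\text{subject to}\quad \dot{x}=Ax+Bu,$$ where $y=Cx$, is a static output feedback, i.e. $u=Ky$ for some constant matrix $K\in\mathbb{R}^{p\times q}$.
   Context: $M>0$ means $M$ is symmetric positive definite. Convention for the optimal control problem: the initial state $x(0)$ is an arbitrary given vector; the minimization is over all input functions $u:[0,\infty)\to\mathbb{R}^{p}$ (say, locally square integrable, so that the state trajectory is well defined), with no requirement that the resulting state trajectory converge to the origin. ''The solution is a static output feedback $u=Ky$'' means that there is one constant matrix $K$, not depending on $x(0)$, such that for every initial state the input generated by the feedback $u(t)=Ky(t)=KCx(t)$ attains the minimum of the cost. *)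

(* Defs.v *)
(* MathComp / MathComp-Analysis. *)
From HB Require Import structures.
From mathcomp Require Import all_boot all_order all_algebra.
From mathcomp Require Import all_classical all_reals all_analysis measurable_realfun.

Set Implicit Arguments.
Unset Strict Implicit.
Unset Printing Implicit Defensive.

Import Order.TTheory GRing.Theory Num.Theory.
Import numFieldNormedType.Exports.

Local Open Scope classical_set_scope.
Local Open Scope ring_scope.

(* v^T M v *)
Definition quad_form (F : realType) (k : nat) (M : 'M[F]_k) (v : 'cV[F]_k) : F :=
  (v^T *m M *m v) 0 0.

Definition posdefmx (F : realType) (k : nat) (M : 'M[F]_k) : Prop :=
  M^T = M /\ (forall v : 'cV[F]_k, v != 0 -> 0 < quad_form M v).

(* Inputs and states are total functions of time, of which only the values on
   [0, +oo[ matter. An admissible input is (Borel) measurable on [0, +oo[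
   and square integrable on every [0, T], componentwise; Borel rather than Lebesgue
   measurability only amounts to changing u on a null set. *)
Definition admissible_input (F : realType) (p : nat) (u : F -> 'cV[F]_p) : Prop :=
  forall i : 'I_p,
    measurable_fun (`[0, +oo[ : set F) (fun t => u t i 0) /\
    (forall T : F, 0 <= T ->
       (@lebesgue_measure F).-integrable `[0, T] (fun t => ((u t i 0) ^+ 2)%:E)).

(* x is the solution on [0, +oo[ of x' = A x + B u, x(0) = x0, in the sense of
   Caratheodory: x(t) = x0 + \int_0^t (A x(s) + B u(s)) ds, i.e. x is locally
   absolutely continuous and satisfies the equation almost everywhere.
   Integrability is required since the integral is a total operator. *)
Definition is_trajectory (F : realType) (n p : nat)
    (A : 'M[F]_n) (B : 'M[F]_(n, p))
    (x0 : 'cV[F]_n) (u : F -> 'cV[F]_p) (x : F -> 'cV[F]_n) : Prop :=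
  forall (t : F) (i : 'I_n), 0 <= t ->
    (@lebesgue_measure F).-integrable `[0, t]
      (fun s => ((A *m x s + B *m u s) i 0)%:E) /\
    x t i 0 = x0 i 0 +
      \int[@lebesgue_measure F]_(s in `[0, t]) (A *m x s + B *m u s) i 0.

Definition controllable (F : realType) (n p : nat)
    (A : 'M[F]_n) (B : 'M[F]_(n, p)) : Prop :=
  forall x0 x1 : 'cV[F]_n,
    exists (T : F) (u : F -> 'cV[F]_p) (x : F -> 'cV[F]_n),
      [/\ 0 < T, admissible_input u, is_trajectory A B x0 u x & x T = x1].

(* Valued in the extended reals: the cost of an admissible input may be +oo. *)
Definition lqr_cost (F : realType) (n p q : nat) (C : 'M[F]_(q, n))
    (Q : 'M[F]_q) (R : 'M[F]_p)
    (u : F -> 'cV[F]_p) (x : F -> 'cV[F]_n) : \bar F :=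
  (\int[@lebesgue_measure F]_(t in `[0%R, +oo[)
     (quad_form Q (C *m x t) + quad_form R (u t))%:E)%E.

(* The input u, with its state trajectory x, minimizes the cost among all
   admissible inputs; no behaviour at infinity is imposed on the state. *)
Definition lqr_solution (F : realType) (n p q : nat)
    (A : 'M[F]_n) (B : 'M[F]_(n, p)) (C : 'M[F]_(q, n))
    (Q : 'M[F]_q) (R : 'M[F]_p) (x0 : 'cV[F]_n)
    (u : F -> 'cV[F]_p) (x : F -> 'cV[F]_n) : Prop :=
  [/\ admissible_input u,
      is_trajectory A B x0 u x &
      forall (v : F -> 'cV[F]_p) (z : F -> 'cV[F]_n),
        admissible_input v -> is_trajectory A B x0 v z ->
        (lqr_cost C Q R u x <= lqr_cost C Q R v z)%E].

(* Main.v *)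
Require Import Defs.
From HB Require Import structures.
From mathcomp Require Import all_boot all_order all_algebra.
From mathcomp Require Import all_classical all_reals all_analysis measurable_realfun.
From mathcomp Require Import ring lra.

Set Implicit Arguments.
Unset Strict Implicit.
Unset Printing Implicit Defensive.

Import Order.TTheory GRing.Theory Num.Theory.
Import numFieldNormedType.Exports.

Local Open Scope classical_set_scope.
Local Open Scope ring_scope.

(** The hypothesis [C *m A = At *m C] makes the output [y = C x] of the plant
    the state of a smaller system [y' = At y + (C B) u], and the cost depends on
    [y] and [u] only.  The problem is therefore a full-state regulator problem
    for the controllable pair [(At, C B)] with positive definite weights, whose
    optimal feedback [u = K y] is by construction an output feedback.

    That problem is solved through a positive definite solution [P] of its
    algebraic Riccati equation and [K = - R^-1 (C B)^T P].  Along every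
    trajectory the value [V t = y^T P y] satisfies
    [V' = (u - K y)^T R (u - K y) - (y^T Q y + u^T R u)]
    ([completion_of_squares]).  For [u = K y] the first term vanishes, so the
    cost is at most [V 0] ([feedback_cost_le]).  For any other input, [V]
    decreases by at most the cost spent; since [Q] is positive definite, [V]
    bounded away from 0 would make the cost infinite, so all of [V 0] has to be
    spent ([value_le_cost]).  No convergence of the state has to be assumed.

    Two ingredients remain.

    - The solution [P] ([riccati_exists]) comes from policy iteration: a
      stabilizing gain is evaluated by a Lyapunov equation, its cost matrix
      yields a better gain, and the cost matrices decrease to [P].  Stability
      is never expressed through eigenvalues: a matrix is stable when some
      positive definite [P] certifies it, and the comparison principle
      [lyapunov_monotone] replaces spectral arguments.  The iteration
      starts from Bass' gain ([bass_stabilizer]), which exists because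
      controllability forbids a row space invariant under [At] and
      annihilating [C B] ([controllable_reach]).

    - Trajectories are only absolutely continuous, so that [V'] is computed
      with a product rule for indefinite integrals of integrable functions
      ([primitiveM]), which is Fubini's theorem on a triangle. *)

(** * Bilinear forms and positive definite matrices *)

Definition bil (F : realType) k l (M : 'M[F]_(k, l))
    (u : 'cV[F]_k) (v : 'cV[F]_l) : F :=
  (u^T *m M *m v) 0 0.

Section Bilinear.
Variable F : realType.
Implicit Types k l m : nat.

Lemma quad_formE k (M : 'M[F]_k) v : quad_form M v = bil M v v.
Proof. by []. Qed.

Lemma bilE k l (M : 'M[F]_(k, l)) u v :
  bil M u v = \sum_i \sum_j M i j * (u i 0 * v j 0).
Proof.
rewrite /bil mxE exchange_big /=; apply: eq_bigr => j _.
rewrite mxE mulr_suml; apply: eq_bigr => i _.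
by rewrite mxE mulrA [M i j * _]mulrC.
Qed.

Lemma bilT k l (M : 'M[F]_(k, l)) u v : bil M^T v u = bil M u v.
Proof.
rewrite !bilE exchange_big /=; apply: eq_bigr => i _; apply: eq_bigr => j _.
by rewrite mxE [v j 0 * _]mulrC.
Qed.

Lemma bil_sym k (M : 'M[F]_k) u v : M^T = M -> bil M v u = bil M u v.
Proof. by move=> MT; rewrite -{1}MT bilT. Qed.

Lemma bilDl k l (M : 'M[F]_(k, l)) u u' v :
  bil M (u + u') v = bil M u v + bil M u' v.
Proof. by rewrite /bil linearD /= !mulmxDl mxE. Qed.

Lemma bilDr k l (M : 'M[F]_(k, l)) u v v' :
  bil M u (v + v') = bil M u v + bil M u v'.
Proof. by rewrite /bil !mulmxDr mxE. Qed.

Lemma bilZl k l (M : 'M[F]_(k, l)) a u v : bil M (a *: u) v = a * bil M u v.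
Proof. by rewrite /bil linearZ /= -!scalemxAl mxE. Qed.

Lemma bilZr k l (M : 'M[F]_(k, l)) a u v : bil M u (a *: v) = a * bil M u v.
Proof. by rewrite /bil -!scalemxAr mxE. Qed.

Lemma bilNl k l (M : 'M[F]_(k, l)) u v : bil M (- u) v = - bil M u v.
Proof. by rewrite -scaleN1r bilZl mulN1r. Qed.

Lemma bilNr k l (M : 'M[F]_(k, l)) u v : bil M u (- v) = - bil M u v.
Proof. by rewrite -scaleN1r bilZr mulN1r. Qed.

Lemma bilMD k l (M N : 'M[F]_(k, l)) u v :
  bil (M + N) u v = bil M u v + bil N u v.
Proof. by rewrite /bil mulmxDr mulmxDl mxE. Qed.

Lemma bilMZ k l (M : 'M[F]_(k, l)) a u v : bil (a *: M) u v = a * bil M u v.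
Proof. by rewrite /bil -scalemxAr -scalemxAl mxE. Qed.

Lemma bilMN k l (M : 'M[F]_(k, l)) u v : bil (- M) u v = - bil M u v.
Proof. by rewrite -scaleN1r bilMZ mulN1r. Qed.

Lemma bilM0 k l u v : bil (0 : 'M[F]_(k, l)) u v = 0.
Proof. by rewrite /bil mulmx0 mul0mx mxE. Qed.

Lemma bilMr k l m (M : 'M[F]_(k, l)) (N : 'M[F]_(l, m)) u v :
  bil (M *m N) u v = bil M u (N *m v).
Proof. by rewrite /bil !mulmxA. Qed.

Lemma bilMl k l m (M : 'M[F]_(k, l)) (N : 'M[F]_(k, m)) u v :
  bil (N^T *m M) u v = bil M (N *m u) v.
Proof. by rewrite /bil trmx_mul !mulmxA. Qed.

Lemma bil1C k (u v : 'cV[F]_k) : bil 1%:M u v = bil 1%:M v u.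
Proof. by apply: bil_sym; rewrite trmx1. Qed.

Lemma bil_delta k l (M : 'M[F]_(k, l)) i j :
  bil M (delta_mx i 0) (delta_mx j 0) = M i j.
Proof.
by rewrite /bil trmx_delta -rowE -colE !mxE.
Qed.

Lemma sqn_ge0 k (v : 'cV[F]_k) : 0 <= bil 1%:M v v.
Proof.
by rewrite /bil mulmx1 mxE sumr_ge0// => i _; rewrite mxE -expr2 sqr_ge0.
Qed.

Lemma sqn_eq0 k (v : 'cV[F]_k) : bil 1%:M v v = 0 -> v = 0.
Proof.
rewrite /bil mulmx1 mxE => /eqP; rewrite psumr_eq0; last first.
  by move=> i _; rewrite mxE -expr2 sqr_ge0.
move=> /allP h; apply/colP => i; rewrite mxE.
have := h i (mem_index_enum _).
by rewrite mxE mulf_eq0 orbb => /eqP.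
Qed.

Lemma sqn_gt0 k (v : 'cV[F]_k) : v != 0 -> 0 < bil 1%:M v v.
Proof.
by rewrite lt_neqAle sqn_ge0 andbT; apply: contra_neq => /esym/sqn_eq0.
Qed.

Lemma bil_mx0 k l (M : 'M[F]_(k, l)) v :
  (forall u, bil M u v = 0) -> M *m v = 0.
Proof.
by move=> h; apply: sqn_eq0; rewrite -[LHS](bilMr 1%:M) mul1mx h.
Qed.

Lemma sym_qf_eq0 k (M : 'M[F]_k) :
  M^T = M -> (forall v, bil M v v = 0) -> M = 0.
Proof.
move=> MT h; apply/matrixP => i j; rewrite mxE -bil_delta.
have := h (delta_mx i 0 + delta_mx j 0).
rewrite bilDl !bilDr !h (bil_sym (delta_mx i 0) (delta_mx j 0)) //. lra.
Qed.

Lemma sym_ker_bil k (M : 'M[F]_k) (v w : 'cV[F]_k) :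
  M^T = M -> M *m v = 0 -> bil M v w = 0.
Proof. by move=> MT Mv; rewrite -bil_sym // /bil -mulmxA Mv mulmx0 mxE. Qed.

Definition psdmx k (M : 'M[F]_k) := M^T = M /\ forall v, 0 <= bil M v v.

Lemma posdef_psd k (M : 'M[F]_k) : posdefmx M -> psdmx M.
Proof.
move=> [MT h]; split=> // v; have [->|/h/ltW//] := eqVneq v 0.
by rewrite -[0 : 'cV[F]_k](scale0r 0) bilZl mul0r.
Qed.

(** Along a line of direction [v] the form is affine, and an affine function
    bounded below is constant. *)
Lemma psd_ker k (M : 'M[F]_k) (v : 'cV[F]_k) :
  psdmx M -> bil M v v = 0 -> M *m v = 0.
Proof.
move=> [MT M0] v0; apply: bil_mx0 => u.
set b := bil M u v; set c := bil M u u.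
have h t : 0 <= c + 2 * t * b.
  have := M0 (u + t *: v).
  rewrite bilDl !bilDr !bilZl !bilZr v0 (bil_sym u v) // -/b -/c. lra.
apply/eqP; apply: contraT => b0.
(* this [t] makes [c + 2 * t * b] equal to -1 *)
have := h (- (c + 1) / (2 * b)).
have -> : 2 * (- (c + 1) / (2 * b)) * b = - (c + 1) by field.
lra.
Qed.

Lemma psd_posdef k (M : 'M[F]_k) :
  psdmx M -> (forall v : 'cV[F]_k, M *m v = 0 -> v = 0) -> posdefmx M.
Proof.
move=> hM h; split=> [|v v0]; first exact: hM.1.
rewrite quad_formE lt_neqAle hM.2 andbT; apply: contraNneq v0 => e.
by apply/eqP/h/psd_ker.
Qed.

Lemma ker0_unit k (M : 'M[F]_k) :
  (forall v : 'cV[F]_k, M *m v = 0 -> v = 0) -> M \in unitmx.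
Proof.
move=> h; rewrite -unitmx_tr -row_free_unit; apply: inj_row_free => v e.
rewrite -[v]trmxK (h v^T) ?trmx0 //.
by rewrite -[M *m _]trmxK trmx_mul trmxK e trmx0.
Qed.

Lemma posdef_ker k (M : 'M[F]_k) (v : 'cV[F]_k) :
  posdefmx M -> M *m v = 0 -> v = 0.
Proof.
move=> [_ h] e; apply/eqP/contraT => /h.
by rewrite /quad_form -mulmxA e mulmx0 mxE ltxx.
Qed.

Lemma posdef_unit k (M : 'M[F]_k) : posdefmx M -> M \in unitmx.
Proof. by move=> h; apply: ker0_unit => v; apply: posdef_ker. Qed.

(** A coordinate is the [M]-inner product with [w = M^-1 e_i], so the
    Cauchy-Schwarz inequality for [M] bounds it, with constant [w^T M w].
    This gives coercivity of [M] without compactness of the unit sphere. *)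
Lemma posdef_coord k (M : 'M[F]_k) i : posdefmx M ->
  exists2 c, 0 < c & forall v : 'cV[F]_k, v i 0 ^+ 2 <= c * bil M v v.
Proof.
move=> hM; pose w : 'cV[F]_k := invmx M *m delta_mx i 0.
have wi (v : 'cV[F]_k) : bil M v w = v i 0.
  rewrite -bilMr mulmxV ?posdef_unit // /bil mulmx1 mxE (bigD1 i) //= big1.
    by rewrite !mxE !eqxx mulr1 addr0.
  by move=> j ji; rewrite !mxE (negbTE ji) mulr0.
have w0 : w != 0.
  apply/eqP => w0; have := wi (delta_mx i 0).
  rewrite w0 /bil mulmx0 !mxE !eqxx => /esym/eqP; by rewrite oner_eq0.
have c0 : 0 < bil M w w := hM.2 _ w0.
exists (bil M w w) => // v.
have [MT M0] := posdef_psd hM.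
have := M0 (v - (v i 0 / bil M w w) *: w).
rewrite bilDl !bilDr !bilNl !bilNr !bilZl !bilZr (bil_sym v w) // (wi v).
set c := bil M w w in c0 *; set q := bil M v v; set x := v i 0 => h.
have := mulr_ge0 (ltW c0) h.
rewrite (_ : c * _ = c * q - x ^+ 2); last by field; rewrite gt_eqF.
lra.
Qed.

Lemma posdef_dominates k (M X : 'M[F]_k) : posdefmx M ->
  exists2 c, 0 < c & forall v, `|bil X v v| <= c * bil M v v.
Proof.
move=> hM.
have /choice[c hc] : forall i, exists c,
    0 < c /\ forall v : 'cV[F]_k, v i 0 ^+ 2 <= c * bil M v v.
  by move=> i; have [c c0 hc] := posdef_coord i hM; exists c.
exists (1 + \sum_i \sum_j `|X i j| * (c i + c j)).
  rewrite ltr_pwDl // sumr_ge0 // => i _; rewrite sumr_ge0 // => j _.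
  by rewrite mulr_ge0 // addr_ge0 // ltW // (hc _).1.
move=> v; have q0 := (posdef_psd hM).2 v.
rewrite mulrDl mul1r ler_wpDl // bilE mulr_suml.
rewrite (le_trans (ler_norm_sum _ _ _)) //.
apply: ler_sum => i _; rewrite mulr_suml (le_trans (ler_norm_sum _ _ _)) //.
apply: ler_sum => j _; rewrite normrM -mulrA ler_wpM2l // mulrDl ler_norml.
have := (hc i).2 v; have := (hc j).2 v.
have := sqr_ge0 (v i 0 - v j 0); have := sqr_ge0 (v i 0 + v j 0).
have := sqr_ge0 (v i 0); have := sqr_ge0 (v j 0).
rewrite !expr2 => *; apply/andP; split; nra.
Qed.

Lemma posdef1 k : posdefmx (1%:M : 'M[F]_k).
Proof. by split=> [|v v0]; rewrite ?trmx1 // quad_formE sqn_gt0. Qed.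

End Bilinear.

(** * Lyapunov equations *)

Section Lyapunov.
Variable F : realType.
Variable k : nat.
Implicit Types A P X S : 'M[F]_k.

(** Lyapunov's criterion taken as the definition of stability: [v^T P v]
    strictly decreases along the solutions of [v' = A v]. *)
Definition certifies A P :=
  posdefmx P /\ forall v : 'cV[F]_k, v != 0 -> bil P v (A *m v) < 0.

(** Along a stable flow a nonincreasing quadratic form tends to 0, hence is
    nonnegative.  The proof avoids the flow: take the least [m >= 0] with
    [X + m P] positive semidefinite.  If [m > 0], this matrix is singular, and
    on its kernel the decrease of [X + m P] vanishes, whereas that of [m P] is
    strict. *)
Lemma lyapunov_monotone A P X : certifies A P ->
  X^T = X -> (forall v, bil X v (A *m v) <= 0) -> psdmx X.
Proof.
move=> [hP dP] XT dX.
pose E := [set s : F | 0 <= s /\ psdmx (X + s *: P)].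
have PT := hP.1.
have symE s : (X + s *: P)^T = X + s *: P by rewrite linearD linearZ /= XT PT.
have [c c0 hc] := posdef_dominates X hP.
have Ec : E c.
  split; [exact: ltW|split=> // v]; rewrite bilMD bilMZ.
  by have := hc v; rewrite ler_norml => /andP[]; lra.
have lbE : lbound E 0 by move=> s [].
have infE : has_inf E by split; [exists c | exists 0].
pose m := inf E.
have m0 : 0 <= m by apply: lb_le_inf => //; exists c.
have hY : psdmx (X + m *: P).
  split=> // v; rewrite leNgt; apply/negP => neg.
  have [v0|v0] := eqVneq v 0.
    by move: neg; rewrite v0 -[0 : 'cV_k](scale0r 0) bilZl mul0r ltxx.
  have q0 : 0 < bil P v v := hP.2 _ v0.
  (* below [m + e] the form is still negative at [v], against the infimum *)
  pose e := - bil (X + m *: P) v v / bil P v v.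
  have e0 : 0 < e by rewrite divr_gt0 // oppr_gt0.
  have [s [s0 hs] sm] := inf_adherent e0 infE.
  have := hs.2 v; rewrite leNgt => /negP; apply.
  have : s * bil P v v < (m + e) * bil P v v by rewrite ltr_pM2r.
  rewrite [(m + e) * _]mulrDl /e mulfVK ?gt_eqF //.
  rewrite !bilMD !bilMZ; lra.
have [m00|mpos] := eqVneq m 0; first by move: hY; rewrite m00 scale0r addr0.
have {mpos} mpos : 0 < m by rewrite lt_neqAle eq_sym mpos.
have [pd|] := pselect (posdefmx (X + m *: P)).
  (* a definite [X + m P] would leave room to decrease [m] *)
  exfalso; have [d d0 hd] := posdef_dominates P pd.
  pose s := Num.max 0 (m - d^-1).
  have : m <= s.
    apply: ge_inf; first by exists 0.
    split; first by rewrite le_max lexx.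
    split=> // v.
    have qP := (posdef_psd hP).2 v.
    have : (m - d^-1) * bil P v v <= s * bil P v v.
      by rewrite ler_wpM2r // le_max lexx orbT.
    have := le_trans (ler_norm _) (hd v).
    rewrite -ler_pdivrMl // !bilMD !bilMZ. lra.
  apply/negP; rewrite -ltNge gt_max mpos /= gtrBl invr_gt0 //.
move=> npd; exfalso; apply: npd; apply: psd_posdef => // v Yv.
apply/eqP/contraT => v0.
have : bil (X + m *: P) v (A *m v) = 0 by rewrite sym_ker_bil.
rewrite bilMD bilMZ.
have := dX v; have : m * bil P v (A *m v) < 0 by rewrite pmulr_rlt0 // dP.
lra.
Qed.

(** The Lyapunov operator acts on the symmetric part of [X]; adding the
    antisymmetric part makes it an endomorphism of the full matrix space that is
    injective as soon as the Lyapunov operator is so on symmetric matrices. *)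
Let sylv A X : 'M[F]_k := A^T *m (X + X^T) + (X + X^T) *m A + (X - X^T).

Let sylv_linear A : linear (sylv A).
Proof.
move=> a X Y; rewrite /sylv !(linearD, linearZ) /=.
rewrite !(mulmxDl, mulmxDr, linearD, linearZ, linearN) /=.
do ?rewrite -scalemxAl; do ?rewrite -scalemxAr.
apply/matrixP => i j; rewrite !mxE; ring.
Qed.

HB.instance Definition _ A :=
  GRing.isLinear.Build F 'M[F]_k 'M[F]_k _ (sylv A) (sylv_linear A).

(** Comparison gives uniqueness ([X] and [- X] are both nonnegative when the
    right-hand side vanishes), and in finite dimension uniqueness gives
    existence. *)
Lemma lyapunov_solvable A P S : certifies A P -> S^T = S ->
  exists2 X, X^T = X & A^T *m X + X *m A + S = 0.
Proof.
move=> cA ST.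
have sylvT X : (sylv A X)^T = A^T *m (X + X^T) + (X + X^T) *m A - (X - X^T).
  rewrite /sylv !(linearD, linearN) /= !trmx_mul !(linearD) /= !trmxK.
  rewrite !(mulmxDl, mulmxDr); apply/matrixP => i j; rewrite !mxE; ring.
have inj X : sylv A X = 0 -> X = 0.
  move=> e.
  have eT := sylvT X; rewrite e trmx0 in eT.
  have symX : X^T = X.
    apply/matrixP => i j; move/matrixP/(_ i j): e; move/matrixP/(_ i j): eT.
    by rewrite /sylv !mxE; lra.
  have eq0 v : bil X v (A *m v) = 0.
    have : bil (sylv A X) v v = 0 by rewrite e bilM0.
    rewrite /sylv symX subrr addr0 bilMD bilMl bilMr !bilMD.
    rewrite (bil_sym v (A *m v)) //; lra.
  apply: sym_qf_eq0 => // v; apply/eqP; rewrite eq_le; apply/andP; split.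
    rewrite -oppr_ge0 -bilMN.
    have /= h := @lyapunov_monotone A P (- X) cA.
    apply: (h _ _).2; first by rewrite linearN /= symX.
    by move=> w; rewrite bilMN eq0 oppr0.
  by apply: (lyapunov_monotone cA symX _).2 => w; rewrite eq0.
have U : lin_mx (sylv A) \in unitmx.
  rewrite -row_free_unit; apply: inj_row_free => w e.
  rewrite -[w]vec_mxK (inj (vec_mx w)) ?linear0 //.
  by rewrite -[LHS]mxvecK -mul_vec_lin vec_mxK e linear0.
pose X := vec_mx (mxvec (- S) *m invmx (lin_mx (sylv A))).
have e : sylv A X = - S.
  by rewrite -[LHS]mxvecK -mul_vec_lin vec_mxK mulmxKV // mxvecK.
have eT := sylvT X; rewrite e linearN /= ST -e in eT.
have symX : X^T = X.
  by apply/matrixP => i j; move/matrixP/(_ i j): eT; rewrite /sylv !mxE; lra.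
exists (2%:R *: X); first by rewrite linearZ /= symX.
rewrite -[S]opprK -e /sylv symX subrr addr0 -!scalemxAl -!scalemxAr.
rewrite !mulmxDl !mulmxDr !scaler_nat !mulr2n opprD addrACA subrr.
by apply/matrixP => i j; rewrite !mxE; ring.
Qed.

End Lyapunov.

(** * A stabilizing gain *)

Section Bass.
Variable F : realType.

(** Bass' construction.  For [b] large, [- (A + b)^T] is stable, so that
    [(A + b) Z + Z (A + b)^T = 2 B B^T] has a nonnegative solution [Z].  Its
    kernel is invariant under [A^T] and annihilated by [B^T], hence trivial by
    hypothesis; then [Z^-1] certifies [A - B B^T Z^-1], with decay rate [b].
    Controllability enters only through [reach]: no nonzero [N] has a row space
    that is stable under [A] and annihilates [B]. *)
Lemma bass_stabilizer k p (A : 'M[F]_k) (B : 'M[F]_(k, p)) :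
  (forall N D : 'M[F]_k, N *m A = D *m N -> N *m B = 0 -> N = 0) ->
  exists K P, certifies (A + B *m K) P.
Proof.
move=> reach.
have pd1 := posdef1 F k.
have [c c0 hc] := posdef_dominates A pd1.
pose b := c + 1.
pose Ab := - (A^T + b%:M).
have cA : certifies Ab 1%:M.
  split=> // v v0; rewrite -bilMr mul1mx /Ab bilMN bilMD bilT -scalemx1 bilMZ.
  have := hc v; rewrite ler_norml => /andP[+ _].
  by have := sqn_gt0 v0; rewrite /b; lra.
have ST : (2%:R *: (B *m B^T))^T = 2%:R *: (B *m B^T).
  by rewrite linearZ /= trmx_mul trmxK.
have [Z ZT eZ] := lyapunov_solvable cA ST.
have BB w : bil (B *m B^T) w w = bil 1%:M (B^T *m w) (B^T *m w).
  by rewrite -bilMl mulmx1 trmxK bilMr.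
have eq w : bil Z w (A^T *m w) = bil (B *m B^T) w w - b * bil Z w w.
  have : bil (Ab^T *m Z + Z *m Ab + 2%:R *: (B *m B^T)) w w = 0.
    by rewrite eZ bilM0.
  rewrite !bilMD bilMl bilMr (bil_sym w (Ab *m w)) // bilMZ.
  rewrite /Ab mulNmx bilNr mulmxDl bilDr mul_scalar_mx bilZr. lra.
have pZ : psdmx Z.
  apply: (lyapunov_monotone cA ZT) => v.
  rewrite /Ab mulNmx bilNr mulmxDl bilDr mul_scalar_mx bilZr eq BB.
  have := sqn_ge0 (B^T *m v); lra.
have kerB (w : 'cV[F]_k) : Z *m w = 0 -> B^T *m w = 0.
  move=> Zw; have := eq w.
  by rewrite !(sym_ker_bil _ ZT Zw) BB mulr0 subr0 => /esym/sqn_eq0.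
have kerA (w : 'cV[F]_k) : Z *m w = 0 -> Z *m (A^T *m w) = 0.
  move=> Zw.
  have : (Ab^T *m Z + Z *m Ab + 2%:R *: (B *m B^T)) *m w = 0.
    by rewrite eZ mul0mx.
  rewrite !mulmxDl -!mulmxA -scalemxAl -mulmxA kerB // mulmx0 scaler0 addr0.
  rewrite Zw mulmx0 add0r /Ab mulNmx mulmxN mulmxDl mulmxDr mul_scalar_mx.
  rewrite -scalemxAr Zw scaler0 addr0.
  by move/eqP; rewrite oppr_eq0 => /eqP.
have N0 : kermx Z = 0.
  have kerT (i : 'I_k) : Z *m (row i (kermx Z))^T = 0.
    by rewrite -{1}ZT -trmx_mul -row_mul mulmx_ker row0 trmx0.
  have sub : (kermx Z *m A <= kermx Z)%MS.
    apply/row_subP => i; rewrite sub_kermx row_mul; apply/eqP.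
    by apply: (can_inj (@trmxK _ _ _)); rewrite trmx0 !trmx_mul ZT kerA.
  have /submxP[D eD] := sub.
  apply: (reach _ D eD); apply/row_matrixP => i.
  by apply: (can_inj (@trmxK _ _ _)); rewrite row0 row_mul trmx0 trmx_mul kerB.
have uZ : Z \in unitmx by rewrite -row_free_unit -kermx_eq0 N0.
have pdZ : posdefmx Z.
  by apply: psd_posdef => // v Zv; rewrite -[v](mulKmx uZ) Zv mulmx0.
exists (- (B^T *m invmx Z)), (invmx Z).
have iT : (invmx Z)^T = invmx Z by rewrite trmx_inv ZT.
have key w :
    bil (invmx Z) (Z *m w) ((A + B *m - (B^T *m invmx Z)) *m (Z *m w)) =
    - b * bil Z w w.
  rewrite -bilMl ZT mulmxV // mulmxDl bilDr !mulmxN mulNmx bilNr.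
  have -> : B *m (B^T *m invmx Z) *m (Z *m w) = B *m B^T *m w.
    by rewrite -!mulmxA mulKmx.
  rewrite -!bilMr !mul1mx.
  have -> : bil (A *m Z) w w = bil Z w (A^T *m w).
    by rewrite -bilT trmx_mul ZT bilMr.
  by rewrite eq; ring.
have invZ_neq0 (v : 'cV[F]_k) : v != 0 -> invmx Z *m v != 0.
  by move=> v0; apply: contraNneq v0 => e; rewrite -[v](mulKVmx uZ) e mulmx0.
split.
  split=> // v v0; rewrite quad_formE -[v](mulKVmx uZ).
  rewrite -bilMl ZT mulmxV // -bilMr mul1mx; apply: pdZ.2.
  exact: invZ_neq0.
move=> v v0; rewrite -[v](mulKVmx uZ) key mulNr oppr_lt0 mulr_gt0 //.
  by rewrite /b; lra.
by apply: pdZ.2; exact: invZ_neq0.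
Qed.
End Bass.

(** * The Riccati equation by policy iteration *)

Lemma cvg_sumn (F : realType) (T : Type) (G : set_system T) {FG : Filter G}
    (I : Type) (r : seq I) (f : I -> T -> F) (l : I -> F) :
  (forall i, f i t @[t --> G] --> l i) ->
  \sum_(i <- r) f i t @[t --> G] --> \sum_(i <- r) l i.
Proof.
move=> h; elim: r => [|i r IH].
  by rewrite big_nil; under eq_fun do rewrite big_nil; exact: cvg_cst.
by rewrite big_cons; under eq_fun do rewrite big_cons; exact: cvgD.
Qed.

Section Kleinman.
Variable F : realType.
Variables k p : nat.
Variables (A : 'M[F]_k) (B : 'M[F]_(k, p)) (Q : 'M[F]_k) (R : 'M[F]_p).
Hypotheses (hQ : posdefmx Q) (hR : posdefmx R).

Definition lqr_gain (P : 'M[F]_k) : 'M[F]_(p, k) := - (invmx R *m B^T *m P).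

Lemma lqr_gainE P w v : bil R w (lqr_gain P *m v) = - bil P (B *m w) v.
Proof.
rewrite -bilMr mulmxN bilMN -mulmxA mulKVmx ?posdef_unit //.
by rewrite bilMl.
Qed.

(** Riccati supersolutions: [A^T P + P A + Q - P B R^-1 B^T P <= 0], the last
    term being written as the input cost of the gain of [P]. *)
Definition riccati_super P :=
  posdefmx P /\ forall v, 2 * bil P v (A *m v) + bil Q v v <=
                  bil R (lqr_gain P *m v) (lqr_gain P *m v).

(** The Lyapunov equation [(A + B K)^T X + X (A + B K) + Q + K^T R K = 0], which
    makes [v^T X v] the cost of applying a stabilizing [u = K x] from [v].  The
    cross term [X B K] is expressed through the gain of [X]. *)
Definition evaluates (K : 'M[F]_(p, k)) X := forall v,
  2 * bil X v (A *m v) + bil Q v v =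
  2 * bil R (K *m v) (lqr_gain X *m v) - bil R (K *m v) (K *m v).

(** The cost matrix of a stabilizing gain is a Riccati supersolution: compared
    with its Lyapunov equation, the gain of [X] replaces [K] at the benefit
    [(K v - L v)^T R (K v - L v)], [L] being the gain of [X]. *)
Lemma policy_evaluation K P : certifies (A + B *m K) P ->
  exists2 X, riccati_super X & evaluates K X.
Proof.
move=> cP; pose S := Q + K^T *m R *m K.
have [QT Q0] := posdef_psd hQ; have [RT R0] := posdef_psd hR.
have ST : S^T = S by rewrite linearD /= !trmx_mul trmxK QT RT mulmxA.
have [X XT eX] := lyapunov_solvable cP ST.
have ev v : 2 * bil X v ((A + B *m K) *m v) + bil Q v v +
    bil R (K *m v) (K *m v) = 0.
  have : bil ((A + B *m K)^T *m X + X *m (A + B *m K) + S) v v = 0.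
    by rewrite eX bilM0.
  rewrite /S !bilMD bilMl (bilMr X) (bilMr _ K) bilMl.
  by rewrite (bil_sym v (_ *m v)) //; lra.
have ev' : evaluates K X.
  move=> v; have := ev v; rewrite mulmxDl bilDr -mulmxA lqr_gainE.
  by rewrite (bil_sym v (B *m _)) //; lra.
exists X => //; split.
  apply: psd_posdef.
    apply: (lyapunov_monotone cP XT) => v; have := ev v.
    by have := Q0 v; have := R0 (K *m v); lra.
  move=> v Xv; have := ev v.
  rewrite (sym_ker_bil _ XT Xv) => e.
  apply: (posdef_ker hQ); apply: psd_ker; first exact: posdef_psd.
  by have := Q0 v; have := R0 (K *m v); lra.
move=> v; rewrite ev'.
have := R0 (K *m v - lqr_gain X *m v).
rewrite bilDl !bilDr !bilNl !bilNr (bil_sym (K *m v) (lqr_gain X *m v)) //; lra.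
Qed.

Lemma riccati_super_certifies P :
  riccati_super P -> certifies (A + B *m lqr_gain P) P.
Proof.
move=> [hP sP]; split=> // v v0; rewrite mulmxDl bilDr -mulmxA.
rewrite (bil_sym (B *m _) v) ?hP.1 //.
have := sP v; have := hQ.2 v v0; rewrite quad_formE.
have := lqr_gainE P (lqr_gain P *m v) v.
have := (posdef_psd hR).2 (lqr_gain P *m v); lra.
Qed.

(** One step of Kleinman's iteration (Newton's method for the Riccati equation):
    by comparison, the cost matrix of the gain of a supersolution [P] lies
    below [P]. *)
Lemma policy_improvement P : riccati_super P ->
  exists X, [/\ riccati_super X, evaluates (lqr_gain P) X &
    forall v, bil X v v <= bil P v v].
Proof.
move=> sP; have cP := riccati_super_certifies sP.
have [X sX eX] := policy_evaluation cP; exists X; split=> // v.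
have XT := sX.1.1; have PT := sP.1.1.
suff /(_ v) : forall v, 0 <= bil (P - X) v v by rewrite bilMD bilMN; lra.
apply: (lyapunov_monotone cP _ _).2; first by rewrite linearB /= XT PT.
move=> w; rewrite bilMD bilMN mulmxDl !bilDr -mulmxA.
rewrite !(bil_sym (B *m _) w) ?hP.1 //.
have := sP.2 w; have := eX w.
have := lqr_gainE P (lqr_gain P *m w) w.
have := lqr_gainE X (lqr_gain P *m w) w; lra.
Qed.

Lemma cvg_bil k' l (M : 'M[F]_(k', l)) (x : nat -> 'cV[F]_k')
    (y : nat -> 'cV[F]_l)
    (x' : 'cV[F]_k') (y' : 'cV[F]_l) :
  (forall i, x n i 0 @[n --> \oo] --> x' i 0) ->
  (forall i, y n i 0 @[n --> \oo] --> y' i 0) ->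
  bil M (x n) (y n) @[n --> \oo] --> bil M x' y'.
Proof.
move=> hx hy; rewrite bilE.
under eq_fun do rewrite bilE.
apply: cvg_sumn => i; apply: cvg_sumn => j.
by apply: cvgM; [exact: cvg_cst|exact: cvgM].
Qed.

(** The iterates decrease as quadratic forms and are nonnegative, so they
    converge, entrywise by polarization; in the limit the equation of
    [evaluates] becomes the Riccati equation.  The limit is definite since on
    its kernel the Riccati equation forces [Q] to vanish. *)
Lemma riccati_exists K0 P0 : certifies (A + B *m K0) P0 ->
  exists P, posdefmx P /\ forall v, 2 * bil P v (A *m v) + bil Q v v =
    bil R (lqr_gain P *m v) (lqr_gain P *m v).
Proof.
move=> /policy_evaluation[X0 sX0 _].
have [Ps [Ps0 Psn]] : exists Ps : nat -> {P | riccati_super P},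
    Ps 0%N = exist _ X0 sX0 /\ forall n,
    evaluates (lqr_gain (sval (Ps n))) (sval (Ps n.+1)) /\
    (forall v, bil (sval (Ps n.+1)) v v <= bil (sval (Ps n)) v v).
  have := @dependent_choice _ (fun P X : {P | riccati_super P} =>
    evaluates (lqr_gain (sval P)) (sval X) /\
    (forall v, bil (sval X) v v <= bil (sval P) v v)).
  move=> /(_ _ (exist _ X0 sX0))[].
    move=> [P sP]; have [X [sX eX lX]] := cid (policy_improvement sP).
    by exists (exist _ X sX).
  by move=> Ps [? ?]; exists Ps.
pose P n := sval (Ps n).
have sP n : riccati_super (P n) := svalP (Ps n).
have PT n : (P n)^T = P n := (sP n).1.1.
have P0' n v : 0 <= bil (P n) v v := (posdef_psd (sP n).1).2 v.
have cvgq v : cvgn (fun n => bil (P n) v v).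
  apply: nonincreasing_is_cvgn.
    by apply/nonincreasing_seqP => n; exact: (Psn n).2.
  by exists 0 => _ [n _ <-].
have cvgb u v : cvgn (fun n => bil (P n) u v).
  have -> : (fun n => bil (P n) u v) = (fun n =>
      2^-1 * (bil (P n) (u + v) (u + v) - bil (P n) u u - bil (P n) v v)).
    apply/funext => n; rewrite bilDl !bilDr (bil_sym u v) //; by field.
  apply: cvgP; apply: cvgMl_tmp; apply: cvgB; [apply: cvgB|]; exact: cvgq.
pose L := \matrix_(i, j) limn (fun n => P n i j).
have cvgL i j : P n i j @[n --> \oo] --> L i j.
  rewrite mxE; under eq_fun do rewrite -bil_delta. exact: cvgb.
have cvgP u v : bil (P n) u v @[n --> \oo] --> bil L u v.
  rewrite bilE; under eq_fun do rewrite bilE.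
  by apply: cvg_sumn => i; apply: cvg_sumn => j; apply: cvgMr_tmp.
have LT : L^T = L.
  apply/matrixP => i j; rewrite !mxE; congr (limn _).
  by apply/funext => n; rewrite -[in LHS]PT mxE.
have cvgG (v : 'cV[F]_k) i :
    (lqr_gain (P n) *m v) i 0 @[n --> \oo] --> (lqr_gain L *m v) i 0.
  have E X : (lqr_gain X *m v) i 0 =
      - bil X ((invmx R *m B^T)^T *m delta_mx i 0) v.
    rewrite -bilMl trmxK /lqr_gain mulNmx mxE /bil trmx_delta.
    by rewrite -!mulmxA -rowE [in RHS]mxE.
  by rewrite E; under eq_fun do rewrite E; apply: cvgN; exact: cvgP.
exists L.
have are v : 2 * bil L v (A *m v) + bil Q v v =
    bil R (lqr_gain L *m v) (lqr_gain L *m v).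
  pose l n := 2 * bil (P n.+1) v (A *m v) + bil Q v v.
  pose r n := 2 * bil R (lqr_gain (P n) *m v) (lqr_gain (P n.+1) *m v)
              - bil R (lqr_gain (P n) *m v) (lqr_gain (P n) *m v).
  have lr : l = r by apply/funext => n; exact: (Psn n).1.
  have cl : l n @[n --> \oo] --> 2 * bil L v (A *m v) + bil Q v v.
    apply: cvgD; last exact: cvg_cst.
    by apply: cvgMl_tmp; rewrite (cvg_shiftS (fun n => bil (P n) v (A *m v))).
  have cr : r n @[n --> \oo] --> 2 * bil R (lqr_gain L *m v) (lqr_gain L *m v)
     - bil R (lqr_gain L *m v) (lqr_gain L *m v).
    apply: cvgB; last exact: cvg_bil.
    apply: cvgMl_tmp; apply: cvg_bil => // i.
    by rewrite (cvg_shiftS (fun n => (lqr_gain (P n) *m v) i 0)).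
  rewrite lr in cl; rewrite (cvg_unique _ cl cr) //; lra.
split=> //; apply: psd_posdef.
  split=> // v; rewrite -(cvg_lim _ (cvgP v v)) //.
  by apply: limr_ge; [exact: cvgq | apply: nearW => n; exact: P0'].
move=> v Lv; apply: (posdef_ker hQ); apply: psd_ker; first exact: posdef_psd.
have g0 : lqr_gain L *m v = 0.
  by rewrite /lqr_gain mulNmx -[X in - X]mulmxA Lv mulmx0 oppr0.
have := are v; rewrite g0.
by rewrite (sym_ker_bil _ LT Lv) mulr0 add0r => ->; rewrite /bil mulmx0 mxE.
Qed.
End Kleinman.

(** * Integration by parts for indefinite integrals *)

Section ByParts.
Variable F : realType.
Let mu := @lebesgue_measure F.

Let cumulative (f : F -> F) t := \int[mu]_(s in `]-oo, t]) f s.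

Let halfplane_integrand (f g : F -> F) (z : F * F) : \bar F :=
  (if z.2 <= z.1 then f z.1 * g z.2 else 0)%:E.

Let halfplane_measurable f g : measurable_fun setT f -> measurable_fun setT g ->
  measurable_fun setT (halfplane_integrand f g).
Proof.
move=> mf mg; apply/measurable_EFinP; apply: measurable_fun_ifT.
- exact: measurable_fun_ler.
- apply: measurable_funM; first by apply: (measurableT_comp mf).
  by apply: (measurableT_comp mg).
- exact: measurable_cst.
Qed.

Let halfplane_integrable f g :
  mu.-integrable setT (EFin \o f) -> mu.-integrable setT (EFin \o g) ->
  (mu \x mu)%E.-integrable setT (halfplane_integrand f g).
Proof.
move=> intf intg.
have mf : measurable_fun setT f.
  by apply/measurable_EFinP; exact: measurable_int intf.
have mg : measurable_fun setT g.
  by apply/measurable_EFinP; exact: measurable_int intg.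
have mnorm (h : F -> F) : measurable_fun setT h ->
    measurable_fun setT (fun t => `|(h t)%:E|)%E.
  by move=> mh; apply: measurableT_comp => //; apply/measurable_EFinP.
have mh := halfplane_measurable mf mg.
apply/integrable12ltyP => //.
have /integrableP[_ gy] := intg.
have /integrableP[_ fy] := intf.
pose G := fine (\int[mu]_x `|(g x)%:E|)%E.
have GE : (\int[mu]_x `|(g x)%:E|)%E = G%:E.
  by rewrite fineK // ge0_fin_numE // integral_ge0.
apply: (@le_lt_trans _ _ (\int[mu]_t (G%:E * `|(f t)%:E|))%E).
  apply: ge0_le_integral => //.
  - by move=> t _; apply: integral_ge0.
  - have := @measurable_fun_fubini_tonelli_F _ _ _ _ _ mu
      (abse \o halfplane_integrand f g).
    apply; last by move=> x; exact: abse_ge0.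
    exact: measurableT_comp.
  - by apply: measurable_funeM; exact: mnorm.
  move=> t _; rewrite -GE muleC -ge0_integralZl //.
  - apply: ge0_le_integral => //.
    + apply: measurableT_comp => //.
      exact: measurableT_comp mh (measurable_pair1 t).
    + by apply: measurable_funeM; exact: mnorm.
    + move=> s _; rewrite /halfplane_integrand /= -EFinM lee_fin -normrM.
      by case: ifP => // _; rewrite normr0.
  - exact: mnorm.
rewrite ge0_integralZl //.
- by rewrite lte_mul_pinfty // ?lee_fin // fine_ge0 // integral_ge0.
- exact: mnorm.
- by rewrite lee_fin fine_ge0 // integral_ge0.
Qed.

(** Both sides are the integral of [f t * g s] over the half-plane [s <= t],
    sliced along [t] on the left and along [s] on the right. *)
Lemma by_parts_line (f g : F -> F) :
  mu.-integrable setT (EFin \o f) -> mu.-integrable setT (EFin \o g) ->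
  mu.-integrable setT (EFin \o (fun t => f t * cumulative g t)) /\
  \int[mu]_t (f t * cumulative g t) =
  \int[mu]_s (g s * (\int[mu]_t f t - cumulative f s)).
Proof.
move=> intf intg.
have sub (h : F -> F) (A : set F) : measurable A ->
    mu.-integrable setT (EFin \o h) -> mu.-integrable A (EFin \o h).
  by move=> mA; apply: integrableS.
have E1 t : (\int[mu]_s halfplane_integrand f g (t, s))%E =
    (f t * cumulative g t)%:E.
  rewrite /halfplane_integrand /= /cumulative /Rintegral EFinM fineK;
    last first.
    by apply: integrable_fin_num => //; exact: sub.
  rewrite -integralZl //; last exact: sub.
  rewrite [RHS]integral_mkcond; apply: eq_integral => s _.
  rewrite patchE mem_setE in_itv /=; by case: ifP.
have E2 s : (\int[mu]_t halfplane_integrand f g (t, s))%E =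
    (g s * (\int[mu]_t f t - cumulative f s))%:E.
  have -> : \int[mu]_t f t - cumulative f s = \int[mu]_(t in `[s, +oo[) f t.
    rewrite -Rintegral_itv_obnd_cbnd; last exact: sub.
    by rewrite -(@Rintegral_itvB _ _ -oo%O +oo%O) // set_itvNyy.
  rewrite /halfplane_integrand /= /Rintegral EFinM fineK; last first.
    by apply: integrable_fin_num => //; exact: sub.
  rewrite -integralZl //; last exact: sub.
  rewrite [RHS]integral_mkcond; apply: eq_integral => t _.
  rewrite patchE mem_setE in_itv /= andbT -EFinM mulrC; by case: ifP.
have ih := halfplane_integrable intf intg.
split.
  have := integrable_fubini_F ih; apply: eq_integrable => // t _.
  exact: E1.
rewrite /Rintegral; congr fine.
transitivity (\int[mu]_t \int[mu]_s halfplane_integrand f g (t, s))%E.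
  by apply: eq_integral => t _; rewrite E1.
by rewrite (Fubini ih); apply: eq_integral => s _; rewrite -E2.
Qed.

End ByParts.

Section Primitive.
Variable F : realType.
Let mu := @lebesgue_measure F.
Implicit Types a b f g : F -> F.

(** [a] is locally absolutely continuous on the half-line of nonnegative times,
    with derivative [f] almost everywhere. *)
Definition primitive a f := forall t, 0 <= t ->
  mu.-integrable `[0, t] (EFin \o f) /\ a t = a 0 + \int[mu]_(s in `[0, t]) f s.

Lemma eq_primitive a b f g : primitive a f ->
  (forall t, 0 <= t -> a t = b t) -> (forall t, 0 <= t -> f t = g t) ->
  primitive b g.
Proof.
move=> af ab fg t t0; have [i e] := af t t0.
have E : {in `[0, t]%classic, f =1 g}.
  by move=> x; rewrite inE /= in_itv /= => /andP[x0 _]; exact: fg.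
split; first by apply: eq_integrable i => // x xD; rewrite /= E.
by rewrite -!ab // e; congr (_ + _); exact: eq_Rintegral.
Qed.

Lemma primitive_cst c : primitive (fun=> c) (fun=> 0).
Proof.
move=> t t0; split; first exact: integrable0.
by rewrite /Rintegral integral0 addr0.
Qed.

Lemma primitiveD a b f g : primitive a f -> primitive b g ->
  primitive (fun t => a t + b t) (fun t => f t + g t).
Proof.
move=> af bg t t0; have [fi fe] := af t t0; have [gi ge] := bg t t0; split.
  by apply: eq_integrable (integrableD _ fi gi).
by rewrite RintegralD // fe ge addrACA.
Qed.

Lemma primitiveZ c a f :
  primitive a f -> primitive (fun t => c * a t) (fun t => c * f t).
Proof.
move=> af t t0; have [fi fe] := af t t0; split.
  by apply: eq_integrable (integrableZl _ c fi).
by rewrite RintegralZl // fe mulrDr.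
Qed.

Lemma primitive_sum (I : Type) (r : seq I) (a f : I -> F -> F) :
  (forall i, primitive (a i) (f i)) ->
  primitive (fun t => \sum_(i <- r) a i t) (fun t => \sum_(i <- r) f i t).
Proof.
move=> af; elim: r => [|i r IH].
  by apply: eq_primitive (primitive_cst 0) _ _ => t _; rewrite big_nil.
by apply: eq_primitive (primitiveD (af i) IH) _ _ => t _; rewrite big_cons.
Qed.

Let by_parts a b f g T : 0 <= T -> primitive a f -> primitive b g ->
  mu.-integrable `[0, T] (EFin \o (fun t => f t * (b t - b 0))) /\
  \int[mu]_(t in `[0, T]) (f t * (b t - b 0)) =
  \int[mu]_(t in `[0, T]) (g t * (a T - a t)).
Proof.
move=> T0 af bg; set D := `[0, T]%classic.
have mD : measurable (D : set (measurableTypeR F)) by exact: measurable_itv.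
have [fi fe] := af T T0; have [gi ge] := bg T T0.
have fi' : mu.-integrable setT (EFin \o (f \_ D)).
  by rewrite -restrict_EFin; apply/(integrable_mkcond _ mD).
have gi' : mu.-integrable setT (EFin \o (g \_ D)).
  by rewrite -restrict_EFin; apply/(integrable_mkcond _ mD).
have cum h t : t \in D ->
    \int[mu]_(s in `]-oo, t]) (h \_ D) s = \int[mu]_(s in `[0, t]) h s.
  rewrite inE /D /= in_itv /= => /andP[t0 tT].
  rewrite -Rintegral_mkcondr; congr (Rintegral _ _ _).
  apply/seteqP; split => s /=; rewrite !in_itv /=.
    by move=> [-> /andP[->]].
  by move=> /andP[-> st]; rewrite st (le_trans st).
have [hi he] := by_parts_line fi' gi'.
have E1 : (fun t => (f \_ D) t * \int[mu]_(s in `]-oo, t]) (g \_ D) s) =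
          (fun t => f t * (b t - b 0)) \_ D.
  apply/funext => t; rewrite [RHS]patchE; case: ifPn => tD; last first.
    by rewrite patchE (negbTE tD) mul0r.
  rewrite patchE tD cum //; move: tD.
  rewrite inE /D /= in_itv /= => /andP[t0 _].
  by have [_ ->] := bg t t0; rewrite addrAC subrr add0r.
have E2 : (fun s => (g \_ D) s *
             (\int[mu]_t (f \_ D) t - \int[mu]_(s in `]-oo, s]) (f \_ D) s)) =
          (fun t => g t * (a T - a t)) \_ D.
  apply/funext => t; rewrite [RHS]patchE; case: ifPn => tD; last first.
    by rewrite patchE (negbTE tD) mul0r.
  rewrite patchE tD cum // -Rintegral_mkcond; move: tD.
  rewrite inE /D /= in_itv /= => /andP[t0 _].
  have [_ ->] := af t t0; rewrite fe -/D; congr (_ * _); ring.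
split.
  by apply/(integrable_mkcond _ mD); rewrite restrict_EFin -E1.
by rewrite [LHS]Rintegral_mkcond [RHS]Rintegral_mkcond -E1 -E2.
Qed.

(** The product rule is the identity of [by_parts] with the integral of [g]
    written as [b - b 0], once the constants [a 0] and [b 0] are put back. *)
Lemma primitiveM a b f g : primitive a f -> primitive b g ->
  primitive (fun t => a t * b t) (fun t => f t * b t + a t * g t).
Proof.
move=> af bg T T0; have [fi fe] := af T T0; have [gi ge] := bg T T0.
have [fbi fbe] := by_parts T0 af bg; have [gai _] := by_parts T0 bg af.
have i1 : mu.-integrable `[0, T] (EFin \o (fun t => f t * b t)).
  apply: eq_integrable (integrableD _ fbi (integrableZl _ (b 0) fi)) => // t _.
  rewrite /= -EFinM -EFinD; congr EFin; ring.
have i2 : mu.-integrable `[0, T] (EFin \o (fun t => a t * g t)).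
  apply: eq_integrable (integrableD _ gai (integrableZl _ (a 0) gi)) => // t _.
  rewrite /= -EFinM -EFinD; congr EFin; ring.
split; first by apply: eq_integrable (integrableD _ i1 i2).
rewrite RintegralD //.
have -> : \int[mu]_(t in `[0, T]) (f t * b t) =
    \int[mu]_(t in `[0, T]) (f t * (b t - b 0)) +
    b 0 * \int[mu]_(t in `[0, T]) f t.
  rewrite -RintegralZl // -RintegralD //; last first.
    by apply: eq_integrable (integrableZl _ (b 0) fi).
  apply: eq_Rintegral => t _; ring.
have : \int[mu]_(t in `[0, T]) (g t * (a T - a t)) =
    a T * \int[mu]_(t in `[0, T]) g t - \int[mu]_(t in `[0, T]) (a t * g t).
  rewrite -RintegralZl // -RintegralB //; last first.
    by apply: eq_integrable (integrableZl _ (a T) gi).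
  apply: eq_Rintegral => t _; ring.
rewrite fbe => ->.
rewrite (_ : \int[mu]_(t in `[0, T]) g t = b T - b 0); last by rewrite ge; ring.
rewrite (_ : \int[mu]_(t in `[0, T]) f t = a T - a 0); last by rewrite fe; ring.
ring.
Qed.

Lemma primitive_C1 a f : (forall t : F, is_derive t (1 : F) a (f t)) ->
  continuous f -> primitive a f.
Proof.
move=> da cf t t0.
have cft : {within `[0, t], continuous f} by apply: continuous_subspaceT.
split.
  by apply: continuous_compact_integrable => //; exact: segment_compact.
move: t0; rewrite le_eqVlt => /predU1P[<-|t0].
  by rewrite set_itv1 Rintegral_set1 addr0.
rewrite /Rintegral (@continuous_FTC2 _ f a) //.
- by rewrite /= addrCA subrr addr0.
- have ca : continuous a.
    by move=> x; apply: differentiable_continuous; apply/derivable1_diffP.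
  split.
  + by move=> x _.
  + by apply: cvg_at_right_filter; exact: ca.
  + by apply: cvg_at_left_filter; exact: ca.
- by move=> x _; rewrite derive1E derive_val.
Qed.

Lemma half_line_bigcup :
  `[0, +oo[%classic = \bigcup_n `[0, n%:R]%classic :> set F.
Proof.
apply/seteqP; split => x /=; rewrite in_itv /= andbT.
  move=> x0; exists (Num.truncn x).+1 => //=; rewrite in_itv /= x0 /=.
  by rewrite ltW // truncnS_gt.
by move=> [n _] /=; rewrite in_itv /= => /andP[].
Qed.

(** The product rule for [t * a t] has derivative [a t + t * f t]; as [t * f t]
    is measurable too, so is [a]. *)
Lemma primitive_measurable a f :
  primitive a f -> measurable_fun (`[0, +oo[ : set F) a.
Proof.
move=> af.
have idp : primitive id (fun=> 1).
  by apply: primitive_C1; exact: cst_continuous.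
have mn n : measurable_fun (`[0, n%:R]%classic : set F) a.
  have [/measurable_int/measurable_EFinP mp _] := primitiveM idp af (ler0n _ n).
  have [/measurable_int/measurable_EFinP mf _] := af _ (ler0n _ n).
  have -> : a = (fun t => (1 * a t + t * f t) - t * f t).
    by apply/funext => t; rewrite mul1r addrK.
  by apply: measurable_funB => //; apply: measurable_funM => //;
    exact: measurable_id.
by rewrite half_line_bigcup; apply/measurable_fun_bigcup.
Qed.

End Primitive.

(** * Linear differential equations *)

Section Flow.
Variable F : realType.
Variable n : nat.
Implicit Types (M : 'M[F]_n) (v : 'cV[F]_n).

(** The Taylor coefficients at 0 of the [i]-th coordinate of [exp (t M) v]. *)
Let coef M v i k : F := (iter k (mulmx M) v) i 0 / k`!%:R.

Let coef_bound M v i k :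
  `|(iter k (mulmx M) v) i 0| <=
  (\sum_j `|v j 0|) * (\sum_i \sum_j `|M i j|) ^+ k.
Proof.
pose m (w : 'cV[F]_n) := \sum_j `|w j 0|; pose C := \sum_i \sum_j `|M i j|.
have C0 : 0 <= C by apply: sumr_ge0 => ? _; apply: sumr_ge0.
have mi (w : 'cV[F]_n) l : `|w l 0| <= m w.
  by rewrite /m (bigD1 l) //= lerDl sumr_ge0.
apply: le_trans (mi _ i) _; elim: k => [|k IH]; first by rewrite expr0 mulr1.
rewrite iterS exprS mulrCA -/C; apply: le_trans (ler_wpM2l C0 IH).
set w := iter k _ _; rewrite /C mulr_suml /m; apply: ler_sum => l _.
rewrite mxE mulr_suml (le_trans (ler_norm_sum _ _ _)) //; apply: ler_sum => j _.
by rewrite normrM ler_wpM2l // mi.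
Qed.

Let coef_cvg M v i x : cvgn (pseries (coef M v i) x).
Proof.
apply: normed_cvg.
pose m := \sum_j `|v j 0|; pose C := \sum_i \sum_j `|M i j|.
have C0 : 0 <= C by apply: sumr_ge0 => ? _; apply: sumr_ge0.
have m0 : 0 <= m by apply: sumr_ge0.
apply: (@series_le_cvg _ _ (m *: exp_coeff (C * `|x|))) => [k|k|k|].
- exact: normr_ge0.
- by rewrite /= /GRing.scale /= mulr_ge0 // exp_coeff_ge0 // mulr_ge0.
- rewrite /= [leRHS]/GRing.scale /= /coef !normrM normfV normrX.
  rewrite [`|_`!%:R|]ger0_norm ?ler0n //.
  rewrite /exp_coeff /= exprMn -[leLHS]mulrA [_^-1 * _]mulrC !mulrA.
  rewrite -[leRHS]/(m * (C ^+ k * `|x| ^+ k / k`!%:R)) !mulrA.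
  by rewrite ler_wpM2r ?invr_ge0 ?ler0n // ler_wpM2r ?exprn_ge0 // coef_bound.
- by apply: is_cvg_seriesZ; exact: is_cvg_series_exp_coeff.
Qed.

(** Differentiating the series of [v] gives the series of [M v]: this is the
    differential equation, and it spares a separate convergence proof for the
    derived series. *)
Let coef_diffs M v i : pseries_diffs (coef M v i) = coef M (M *m v) i.
Proof.
apply/funext => k; rewrite /pseries_diffs /coef iterSr factS natrM invfM.
by rewrite mulrCA mulVKf.
Qed.

Lemma linear_ode_solution M v : exists x : F -> 'cV[F]_n,
  x 0 = v /\
  forall t i, is_derive (t : F) (1 : F) (fun s => x s i 0) ((M *m x t) i 0).
Proof.
exists (fun t => \col_i limn (pseries (coef M v i) t)); split.
  apply/colP => i; rewrite mxE.
  apply/cvg_lim => //; apply: cvg_near_cst; exists 1%N => // k /= k0.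
  rewrite /pseries /series /= -(prednK k0) big_nat_recl // big1 ?addr0.
    by rewrite expr0 mulr1 /coef /= fact0 divr1.
  by move=> j _; rewrite expr0n mulr0.
move=> t i.
have -> : (fun s => (\col_i limn (pseries (coef M v i) s)) i 0) =
    (fun s => limn (pseries (coef M v i) s)).
  by apply/funext => s; rewrite mxE.
have -> : (M *m (\col_i limn (pseries (coef M v i) t))) i 0 =
    limn (pseries (pseries_diffs (coef M v i)) t).
  rewrite coef_diffs; apply/esym/cvg_lim => //.
  have -> : pseries (coef M (M *m v) i) t =
      (fun k => \sum_j M i j * pseries (coef M v j) t k).
    apply/funext => k; rewrite /pseries /series /=.
    under [RHS]eq_bigr do rewrite mulr_sumr.
    rewrite exchange_big /=; apply: eq_bigr => l _.
    rewrite /coef -iterSr iterS mxE !mulr_suml; apply: eq_bigr => j _.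
    by rewrite !mulrA.
  rewrite mxE; apply: cvg_sumn => j; rewrite mxE.
  by apply: cvgMl_tmp; exact: coef_cvg.
by apply: (@pseries_snd_diffs _ _ (`|t| + 1)); rewrite ?coef_diffs //;
  rewrite [ltRHS]ger0_norm ?ltrDl ?addr_ge0.
Qed.

End Flow.

Section VectorPrimitive.
Variable F : realType.
Let mu := @lebesgue_measure F.

Definition vprimitive k (x f : F -> 'cV[F]_k) :=
  forall i, primitive (fun t => x t i 0) (fun t => f t i 0).

Lemma vprimitiveM k l (N : 'M[F]_(l, k)) (x f : F -> 'cV[F]_k) :
  vprimitive x f -> vprimitive (fun t => N *m x t) (fun t => N *m f t).
Proof.
move=> xf i.
have h := primitive_sum (index_enum _) (fun j => primitiveZ (N i j) (xf j)).
by apply: eq_primitive h _ _ => t _; rewrite mxE.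
Qed.

Lemma primitive_bil k l (M : 'M[F]_(k, l)) (x f : F -> 'cV[F]_k)
    (y g : F -> 'cV[F]_l) : vprimitive x f -> vprimitive y g ->
  primitive (fun t => bil M (x t) (y t))
            (fun t => bil M (f t) (y t) + bil M (x t) (g t)).
Proof.
move=> xf yg.
have h := primitive_sum (index_enum _) (fun i => primitive_sum (index_enum _)
  (fun j => primitiveZ (M i j) (primitiveM (xf i) (yg j)))).
apply: eq_primitive h _ _ => t _; rewrite !bilE // -big_split /=.
apply: eq_bigr => i _.
by rewrite -big_split /=; apply: eq_bigr => j _; rewrite -mulrDr.
Qed.

Lemma primitive_decr (a f : F -> F) : primitive a f ->
  (forall t, 0 <= t -> f t <= 0) ->
  forall t, 0 <= t -> a t <= a 0.
Proof.
move=> af f0 t t0.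
have [_] := primitiveZ (-1) af t0.
have : 0 <= \int[mu]_(s in `[0, t]) (-1 * f s).
  apply: Rintegral_ge0 => s /=; rewrite in_itv /= => /andP[s0 _].
  by rewrite mulN1r oppr_ge0 f0.
rewrite /mu; lra.
Qed.

(** Gronwall's argument: [e^(- 2 c t) |x t|^2] is nonincreasing when [c] bounds
    the quadratic form of [D]. *)
Lemma linear_ode_zero k (D : 'M[F]_k) (x : F -> 'cV[F]_k) :
  vprimitive x (fun t => D *m x t) -> x 0 = 0 -> forall t, 0 <= t -> x t = 0.
Proof.
move=> hx x0 t t0.
have pd1 := posdef1 F k.
have [c c0 hc] := posdef_dominates D pd1.
pose b := 2 * c.
have pe : primitive (fun t => expR (- b * t)) (fun t => - b * expR (- b * t)).
  apply: primitive_C1 => [s|].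
    rewrite mulrC -[X in _ * X]mulr1; apply: is_derive1_comp. 
  move=> s; apply: cvgMl_tmp.
  apply: continuous_comp; last exact: continuous_expR.
  by apply: cvgMl_tmp; exact: cvg_id.
have ps := primitiveM (primitive_bil 1%:M hx hx) pe.
have := primitive_decr ps _ t0; rewrite x0 /=.
rewrite [bil _ 0 0]/bil mulmx0 mxE mul0r => le0; apply: sqn_eq0; apply/eqP.
rewrite eq_le sqn_ge0 andbT -(pmulr_lle0 _ (expR_gt0 (- b * t))).
apply: le0 => s s0.
rewrite (bil1C (D *m x s)) -bilMr mul1mx.
have := hc (x s); rewrite ler_norml => /andP[_ h].
have := expR_gt0 (- b * s); have := sqn_ge0 (x s); rewrite /b.
set E := expR _; move=> q0 E0.
have : E * bil D (x s) (x s) <= E * (c * bil 1%:M (x s) (x s)).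
  by rewrite ler_pM2l.
lra.
Qed.

Lemma trajectoryP n p (A : 'M[F]_n) (B : 'M[F]_(n, p)) x0
    (u : F -> 'cV[F]_p) (x : F -> 'cV[F]_n) :
  is_trajectory A B x0 u x <->
  x 0 = x0 /\ vprimitive x (fun t => A *m x t + B *m u t).
Proof.
split=> [h|[e h] t i t0]; last by have [? ->] := h i t t0; rewrite -e.
have e : x 0 = x0.
  apply/colP => i; have [_ ->] := h 0 i (lexx 0).
  by rewrite set_itv1 Rintegral_set1 addr0.
by split=> // i t t0; have [? ->] := h t i t0; rewrite e.
Qed.

(** Along a trajectory from 0, [N x] solves the autonomous equation
    [w' = D w], because [N] annihilates [B]; so it stays 0, although by
    controllability [x] reaches every state. *)
Lemma controllable_reach q p (A : 'M[F]_q) (B : 'M[F]_(q, p)) :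
  controllable A B ->
  forall N D : 'M[F]_q, N *m A = D *m N -> N *m B = 0 -> N = 0.
Proof.
move=> ctr N D NA NB.
suff h (x1 : 'cV[F]_q) : N *m x1 = 0.
  apply/matrixP => i j.
  by have /colP/(_ i) := h (delta_mx j 0); rewrite -colE !mxE.
have [T [u [x [T0 _ /trajectoryP[x0 hx] <-]]]] := ctr 0 x1.
have hN := vprimitiveM N hx.
apply: (@linear_ode_zero _ D (fun t => N *m x t)) (ltW T0);
  last by rewrite x0 mulmx0.
move=> i; apply: eq_primitive (hN i) _ _ => t _ //.
by rewrite mulmxDr !mulmxA NA NB mul0mx addr0.
Qed.

End VectorPrimitive.

(** * Optimality of the Riccati feedback *)

Section Optimality.
Variable F : realType.
Let mu := @lebesgue_measure F.
Variables q p : nat.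
Variables (A : 'M[F]_q) (B : 'M[F]_(q, p)) (Q : 'M[F]_q) (R : 'M[F]_p).
Variable P : 'M[F]_q.
Hypotheses (hQ : posdefmx Q) (hR : posdefmx R) (hP : posdefmx P).
Hypothesis are : forall v, 2 * bil P v (A *m v) + bil Q v v =
  bil R (lqr_gain B R P *m v) (lqr_gain B R P *m v).
Variables (y : F -> 'cV[F]_q) (u : F -> 'cV[F]_p).
Hypothesis hy : vprimitive y (fun t => A *m y t + B *m u t).
Hypothesis measurable_u :
  forall i, measurable_fun (`[0, +oo[ : set F) (fun t => u t i 0).

Let V t := bil P (y t) (y t).
Let L t := bil Q (y t) (y t) + bil R (u t) (u t).
Let dev t := u t - lqr_gain B R P *m y t.

Let L_ge0 t : 0 <= L t.
Proof. by rewrite addr_ge0 // (posdef_psd _).2. Qed.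

(** The Riccati equation turns the terms of [V'] quadratic in [y] into
    [(K y)^T R (K y) - y^T Q y], and [R K = - B^T P] turns the mixed term into
    [- 2 u^T R (K y)]. *)
Lemma completion_of_squares :
  primitive V (fun t => bil R (dev t) (dev t) - L t).
Proof.
apply: eq_primitive (primitive_bil P hy hy) _ _ => t _ //.
rewrite (bil_sym (y t)) ?hP.1 // bilDr.
rewrite (bil_sym (B *m u t)) ?hP.1 //.
have := lqr_gainE B hR P (u t) (y t); have := are (y t).
rewrite /dev /L bilDl !bilDr !bilNl !bilNr (bil_sym (u t) (_ *m _)) ?hR.1 //.
rewrite (bil_sym (y t) (B *m u t)) ?hP.1 //.
lra.
Qed.

Lemma running_cost_measurable : measurable_fun (`[0, +oo[ : set F) L.
Proof.
have my i : measurable_fun (`[0, +oo[ : set F) (fun t => y t i 0).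
  exact: primitive_measurable (hy i).
have mb k (M : 'M[F]_k) (w : F -> 'cV[F]_k) :
    (forall i, measurable_fun (`[0, +oo[ : set F) (fun t => w t i 0)) ->
    measurable_fun (`[0, +oo[ : set F) (fun t => bil M (w t) (w t)).
  move=> mw.
  rewrite (_ : (fun t => bil M (w t) (w t)) =
    fun t => \sum_i \sum_j M i j * (w t i 0 * w t j 0)); last first.
    by apply/funext => t; rewrite bilE.
  apply: measurable_sum => i; apply: measurable_sum => j.
  by apply: measurable_funM => //; apply: measurable_funM.
by apply: measurable_funD; apply: mb.
Qed.

(** For an input that is merely measurable the running cost [L] may have an
    infinite integral, so it is compared with the positive part of the decrease
    rate of [V], which is integrable. *)
Lemma value_decrease_le T : 0 <= T ->
  ((V 0 - V T)%:E <= \int[mu]_(t in `[0%R, T]) (L t)%:E)%E.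
Proof.
move=> T0; have [hi he] := primitiveZ (-1) completion_of_squares T0.
pose h t := -1 * (bil R (dev t) (dev t) - L t); rewrite -/h in hi he.
have -> : V 0 - V T = \int[mu]_(t in `[0, T]) h t by move: he; lra.
rewrite /Rintegral fineK; last exact: integrable_fin_num hi.
have mL : measurable_fun `[0, T] L.
  apply: measurable_funS running_cost_measurable => //.
  by apply: subset_itvl.
apply: le_trans (_ : (_ <= \int[mu]_(t in `[0%R, T]) (h^\+ t)%:E)%E) _.
  apply: le_integral => //; first exact: integrable_funrpos.
  by move=> t _; rewrite lee_fin /funrpos le_max lexx.
apply: ge0_le_integral => //.
- by move=> t _; rewrite lee_fin /funrpos le_max lexx orbT.
- apply/measurable_EFinP; apply: measurable_funrpos; apply/measurable_EFinP.
  exact: measurable_int hi.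
- exact/measurable_EFinP.
move=> t _; rewrite lee_fin /funrpos ge_max L_ge0 andbT /h.
by have := (posdef_psd hR).2 (dev t); lra.
Qed.

(** If the cost fell short of [V 0] by [e > 0], then [V] would stay above [e],
    hence [y^T Q y] above a positive constant on the whole half-line, and the
    cost would be infinite. *)
Lemma value_le_cost : ((V 0)%:E <= \int[mu]_(t in `[0%R, +oo[) (L t)%:E)%E.
Proof.
rewrite leNgt; apply/negP => lt.
have mL := running_cost_measurable.
set J := (\int[mu]_(t in _) _)%E in lt.
have J0 : (0 <= J)%E by apply: integral_ge0 => t _; rewrite lee_fin.
have Jfin : J \is a fin_num by rewrite ge0_fin_numE // (lt_trans lt) // ltry.
pose e := V 0 - fine J.
have e0 : 0 < e by rewrite subr_gt0 -lte_fin fineK.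
have VT T : 0 <= T -> e <= V T.
  move=> T0; have := value_decrease_le T0.
  have : (\int[mu]_(t in `[0%R, T]) (L t)%:E <= J)%E.
    apply: ge0_subset_integral => //; first exact/measurable_EFinP.
      by move=> t _; rewrite lee_fin.
    exact: subset_itvl.
  move=> /[swap] /le_trans /[apply]; rewrite -(fineK Jfin) lee_fin /e; lra.
have [c c0 hc] := posdef_dominates P hQ.
have LT T : 0 <= T -> e / c <= L T.
  move=> T0; rewrite ler_pdivrMr //; apply: le_trans (VT T T0) _.
  apply: le_trans (ler_norm _) _; apply: le_trans (hc _) _.
  by rewrite mulrC ler_wpM2r ?(ltW c0) // lerDl (posdef_psd hR).2.
have : (\int[mu]_(t in `[0%R, +oo[) (cst (e / c)%:E t) <= J)%E.
  apply: ge0_le_integral => //.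
  - by move=> t _; rewrite lee_fin divr_ge0 // ltW.
  - exact/measurable_EFinP.
  - by move=> t; rewrite /= in_itv /= andbT lee_fin; exact: LT.
rewrite integral_cst //= lebesgue_measure_itv /= ltry.
rewrite gt0_muley ?lte_fin ?divr_gt0 //.
by rewrite leye_eq => /eqP Jy; rewrite Jy in Jfin.
Qed.

Lemma feedback_cost_le : (forall t, 0 <= t -> u t = lqr_gain B R P *m y t) ->
  (\int[mu]_(t in `[0%R, +oo[) (L t)%:E <= (V 0)%:E)%E.
Proof.
move=> hu; have mL := running_cost_measurable.
rewrite half_line_bigcup.
have cv : (\int[mu]_(t in `[0%R, n%:R]) (L t)%:E @[n --> \oo] -->
    \int[mu]_(t in \bigcup_n (`[0%R, n%:R]%classic : set F)) (L t)%:E)%E.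
  apply: ge0_nondecreasing_set_cvg_integral => //.
  - apply/nondecreasing_seqP => n; rewrite subsetEset; apply: subset_itvl.
    by rewrite bnd_simp ler_nat.
  - move=> n; apply/measurable_EFinP; apply: measurable_funS mL => //.
    exact: subset_itvl.
  - by move=> n t _; rewrite lee_fin.
rewrite -(cvg_lim _ cv) //; apply: lime_le; first by apply: cvgP cv.
apply: nearW => n.
have [hi he] := primitiveZ (-1) completion_of_squares (ler0n F n).
pose h t := -1 * (bil R (dev t) (dev t) - L t); rewrite -/h in hi he.
have hL : {in `[0, n%:R]%classic, h =1 L}.
  move=> t; rewrite inE /= in_itv /= => /andP[t0 _].
  by rewrite /h /dev hu // subrr /bil mulmx0 mxE; lra.
have -> : (\int[mu]_(t in `[0%R, n%:R]) (L t)%:E =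
           \int[mu]_(t in `[0%R, n%:R]) (h t)%:E)%E.
  by apply: eq_integral => t tn; rewrite hL.
rewrite -[leLHS]fineK; last exact: integrable_fin_num hi.
rewrite lee_fin; have := (posdef_psd hP).2 (y n%:R); rewrite -/(V _).
move: he; rewrite /Rintegral; lra.
Qed.

End Optimality.

Theorem proposition4 (F : realType) (n p q : nat)
    (A : 'M[F]_n) (B : 'M[F]_(n, p)) (C : 'M[F]_(q, n))
    (Q : 'M[F]_q) (R : 'M[F]_p)
    (hA : exists At : 'M[F]_q, C *m A = At *m C /\ controllable At (C *m B))
    (hQ : posdefmx Q) (hR : posdefmx R) :
  exists K : 'M[F]_(p, q), forall x0 : 'cV[F]_n,
    exists x : F -> 'cV[F]_n,
      lqr_solution A B C Q R x0 (fun t => K *m (C *m x t)) x.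
Proof.
have [At [CA ctr]] := hA.
have [K0 [P0 cP0]] := bass_stabilizer (controllable_reach ctr).
have [P [hP are]] := riccati_exists hQ hR cP0.
pose K := lqr_gain (C *m B) R P; exists K => x0.
(* the output is a state: it obeys a differential equation of its own *)
have output u x : is_trajectory A B x0 u x ->
    vprimitive (fun t => C *m x t)
               (fun t => At *m (C *m x t) + (C *m B) *m u t).
  move=> /trajectoryP[_ /(vprimitiveM C) h] i.
  apply: eq_primitive (h i) _ _ => t _ //.
  by rewrite mulmxDr !mulmxA CA.
have [x [xx0 dx]] := linear_ode_solution (A + B *m K *m C) x0.
have cx i : continuous (fun t => x t i 0).
  move=> t; apply: differentiable_continuous; apply/derivable1_diffP.
  by have := dx t i.
have cMx m (M : 'M[F]_(m, n)) i : continuous (fun t => (M *m x t) i 0).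
  rewrite (_ : (fun t => _) = fun s => \sum_j M i j * x s j 0); last first.
    by apply/funext => s; rewrite mxE.
  by move=> t; apply: cvg_sumn => j; apply: cvgMl_tmp; exact: cx.
have trx : is_trajectory A B x0 (fun t => K *m (C *m x t)) x.
  apply/trajectoryP; split=> // i.
  apply: (@eq_primitive _ (fun t => x t i 0) _
    (fun t => ((A + B *m K *m C) *m x t) i 0)) => //.
    by apply: primitive_C1 => //; exact: cMx.
  by move=> t _; rewrite mulmxDl !mulmxA.
have adm : admissible_input (fun t => K *m (C *m x t)).
  move=> i; have cu : continuous (fun t => (K *m (C *m x t)) i 0).
    by under eq_fun do rewrite mulmxA; exact: cMx.
  split; first by apply: measurable_funTS; exact: continuous_measurable_fun.
  move=> T _; apply: continuous_compact_integrable.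
    exact: segment_compact.
  by apply: continuous_subspaceT => t; apply: cvgM; exact: cu.
exists x; split=> // v z hv hz.
have yz0 : C *m z 0 = C *m x 0 by have /trajectoryP[-> _] := hz; rewrite xx0.
apply: (@le_trans _ _ (bil P (C *m x 0) (C *m x 0))%:E).
  apply: (feedback_cost_le hQ hR hP are (output _ _ trx)) => // i.
  by have [] := adm i.
rewrite -yz0.
by apply: (value_le_cost hQ hR hP are (output _ _ hz)) => i; have [] := hv i.
Qed.
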